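(* Let $R=(V,A)$ be a digraph with $n=|V|$ vertices and $cc$ (weakly) connected components, let $f$ be the size of a minimum directed feedback vertex set of $R$, and let $k$ be a nonnegative integer. Then there exists a temporal digraph $\mathcal G=(V,\mathcal E)$ with at most $k$ temporal arcs such that for every arc $(u,v)\in A$ there is a journey from $u$ to $v$ in $\mathcal G$ if and only if $k\geq n+f-cc$.
   Context: A temporal digraph is a pair $\mathcal G=(V,\mathcal E)$ where $V$ is a finite vertex set and $\mathcal E$ is a finite set of (distinct) temporal arcs, a temporal arc being a pair $((u,v),t)$ with $u\neq v\in V$ and $t$ a positive integer (its appearance time). A journey from $u_0$ to $u_k$ is a sequence $(u_0,u_1,t_0),(u_1,u_2,t_1),\dots,(u_{k-1},u_k,t_{k-1})$ such that each $((u_i,u_{i+1}),t_i)\in\mathcal E$ and $t_0<t_1<\dots<t_{k-1}$ (strictly increasing times). A directed feedback vertex set (DFVS) of a digraph is a vertex set $S$ such that every circuit (directed cycle) of the digraph contains a vertex of $S$. Connected components of a digraph are those of its underlying undirected graph. *)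

(* Defs.v *)
From mathcomp Require Import all_boot.
From mathcomp Require Export finmap.

Set Implicit Arguments.
Unset Strict Implicit.
Unset Printing Implicit Defensive.

Local Open Scope fset_scope.

(* [((u, v), t)] is the temporal arc from [u] to [v] appearing at time [t]. *)
Notation tarc V := (V * V * nat)%type (only parsing).

Record temporal_digraph (V : finType) := TemporalDigraph {
  tarcs : {fset tarc V};
  tarcs_loopless : forall u v t, (u, v, t) \in tarcs -> u != v;
  tarcs_time_gt0 : forall u v t, (u, v, t) \in tarcs -> 0 < t
}.

Section Journeys.
Variable V : finType.

Definition tsrc (e : tarc V) : V := e.1.1.
Definition tdst (e : tarc V) : V := e.1.2.
Definition ttime (e : tarc V) : nat := e.2.

Definition tstep : rel (tarc V) :=
  fun e e' => (tdst e == tsrc e') && (ttime e < ttime e').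

(* The empty sequence is the trivial journey from a vertex to itself. *)
Definition is_journey (G : temporal_digraph V) (u v : V) (J : seq (tarc V)) :=
  [/\ forall e : tarc V, e \in J -> e \in tarcs G,
      sorted tstep J
    & if J is e :: p then tsrc e = u /\ tdst (last e p) = v else u = v].

Definition has_journey (G : temporal_digraph V) (u v : V) : Prop :=
  exists J : seq (tarc V), is_journey G u v J.

End Journeys.

Section Digraphs.
Variables (V : finType) (A : rel V).

(* [ucycle A c] also holds for the empty sequence, which is not a circuit. *)
Definition circuit (c : seq V) : Prop := c <> [::] /\ ucycle A c.

Definition dfvs (S : {set V}) : Prop :=
  forall c, circuit c -> exists2 x, x \in c & x \in S.

Definition min_dfvs_size (f : nat) : Prop :=
  (exists2 S : {set V}, dfvs S & #|S| = f) /\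
  (forall S : {set V}, dfvs S -> f <= #|S|).

Definition underlying : rel V := fun x y => A x y || A y x.

Definition num_cc : nat := n_comp underlying predT.

End Digraphs.

(* Main.v *)
Require Import Defs.
From mathcomp Require Import all_boot finmap.

(** Upper bound: if [S] is a DFVS, traverse in each component [C], at times
    1, 2, ..., the vertices of [S] in [C], then the rest of [C] in a topological
    order, then the vertices of [S] in [C] again; the tail of every arc occurs
    before some occurrence of its head, and the walk has [|C| + |S :&: C| - 1] steps.

    Lower bound: insert the temporal arcs from the latest to the earliest.  A new
    earliest arc [u -> v] can only be the first arc of a journey, so it only
    creates journeys out of [u], towards the component of [v].  If [u] and [v] lie
    in distinct components, acyclicity of reachability outside the current
    DFVS is preserved; otherwise add [u] to the DFVS.  Hence a DFVS of size at
    most [|E| - n + cc] is obtained. *)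

Set Implicit Arguments.
Unset Strict Implicit.
Unset Printing Implicit Defensive.

Lemma sorted_mem2 (T : eqType) (leT : rel T) (s : seq T) (x y : T) :
  reflexive leT -> transitive leT -> sorted leT s ->
  x \in s -> y \in s -> ~~ leT y x -> mem2 s x y.
Proof.
move=> leT_refl leT_tr s_sorted xs ys; apply: contraR.
rewrite /mem2 => y_notin.
apply: (sorted_leq_index leT_tr leT_refl s_sorted) => //; apply: ltnW.
have := ys; rewrite -{1}(cat_take_drop (index x s) s) mem_cat (negPf y_notin) orbF.
by rewrite in_take.
Qed.

(** * Journeys over a list of temporal arcs *)

Section Journeys.
Variable V : finType.
Implicit Types (E J : seq (tarc V)) (u v x y : V) (w : seq V).

(** The arcs form a plain list, free of conditions on loops and times, so that induction can remove
    them one at a time. *)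
Definition seq_journey E u v J :=
  [/\ {subset J <= E}, sorted (@tstep V) J
    & if J is e :: p then tsrc e = u /\ tdst (last e p) = v else u = v].

Definition reach E u v := exists J, seq_journey E u v J.

Lemma has_journeyE (G : temporal_digraph V) E u v :
  tarcs G =i E -> has_journey G u v <-> reach E u v.
Proof.
by move=> eqE; split=> -[J [JE Js uv]]; exists J; split=> // e /JE; rewrite eqE.
Qed.

Lemma reach_sub E E' u v : {subset E <= E'} -> reach E u v -> reach E' u v.
Proof. by move=> sub [J [JE Js uv]]; exists J; split=> // e /JE/sub. Qed.

Lemma tstep_time_trans : transitive (fun e e' : tarc V => ttime e < ttime e').
Proof. by move=> ???; apply: ltn_trans. Qed.

Lemma path_tstep_time e J :
  path (@tstep V) e J -> all (fun e' => ttime e < ttime e') J.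
Proof.
move=> eJ; apply: order_path_min tstep_time_trans _.
by apply: sub_path eJ => ?? /andP[].
Qed.

(* An arc of minimal time can only be the first one of a journey. *)
Lemma reach_cons e E u v :
    {in E, forall e', ttime e <= ttime e'} -> reach (e :: E) u v ->
  reach E u v \/ u = tsrc e /\ reach E (tdst e) v.
Proof.
move=> e_min [[|a J] [JE Js uv]]; first by left; exists [::].
have late : {subset J <= E}.
  move=> b bJ; have /allP/(_ b bJ) lt_ab := path_tstep_time Js.
  have:= JE b; rewrite !inE bJ orbT => /(_ isT)/predU1P[eq_be|//].
  have:= JE a; rewrite !inE eqxx => /(_ isT)/predU1P[eq_ae|/e_min].
    by move: lt_ab; rewrite eq_ae eq_be ltnn.
  by rewrite -eq_be leqNgt lt_ab.
case: uv => au Jv.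
have:= JE a; rewrite !inE eqxx => /(_ isT)/predU1P[eq_ae|aE]; last first.
  left; exists (a :: J); split=> // b; rewrite inE => /predU1P[->//|].
  exact: late.
right; rewrite -eq_ae; split=> //; exists J; split=> //.
  exact: path_sorted Js.
by case: J Js Jv {JE late} => [|b J] //= /andP[/andP[/eqP-> _] _].
Qed.

(** The labels [c] stand for components and the rank [g] certifies acyclicity outside [S]. Each arc
    pays for one new element of [S] or for the merging of two labels. *)
Lemma feedback_labelling E : sorted (fun e e' => ttime e <= ttime e') E ->
  exists S : {set V}, exists g : V -> nat, exists c : V -> V,
  [/\ #|S| + #|V| <= size E + #|c @: V|,
      forall u v, reach E u v -> c u = c v
    & forall u v, u \notin S -> v \notin S -> u != v -> reach E u v -> g u < g v].
Proof.
elim: E => [|e E IH] E_sorted.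
  exists set0; exists (fun=> 0); exists id.
  have nil u v : reach [::] u v -> u = v.
    by case=> -[|a J] [JE _ //]; have:= JE a; rewrite !inE eqxx => /(_ isT).
  split=> [|//|u v _ _ /eqP neq_uv /nil //].
  by rewrite cards0 card_imset.
have [S [g [c [le_size c_reach g_reach]]]] := IH (path_sorted E_sorted).
have e_min : {in E, forall e', ttime e <= ttime e'}.
  by apply/allP; apply: order_path_min E_sorted => a b d; apply: leq_trans.
set u0 := tsrc e; set v0 := tdst e.
have [same|diff] := eqVneq (c u0) (c v0).
  (* Every new journey starts at [u0], so [g] stays valid once [u0] is in [S]. *)
  exists (u0 |: S); exists g; exists c; split.
  - rewrite /= addSn cardsU1 -addnA; case: (u0 \notin S); first by rewrite add1n ltnS.
    by rewrite add0n leqW.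
  - by move=> u v /(reach_cons e_min)[/c_reach//|[-> /c_reach <-]].
  move=> u v; rewrite !in_setU1 !negb_or => /andP[/eqP neq_u uS] /andP[_ vS] uv.
  by case/(reach_cons e_min)=> [/g_reach->//|[]].
(* The class of [v0] is lifted above all values of [g], hence above [g u0]. Old journeys stay inside
   one class, where the shift is constant. *)
pose g' x := g x + (c x == c v0) * (\max_x g x).+1.
exists S; exists g'; exists (fun x => if c x == c v0 then c u0 else c x); split.
- apply: leq_trans le_size _; rewrite /= addSnnS leq_add2l.
  rewrite (cardsD1 (c v0)) -[X in _ <= X]add1n leq_add ?leq_b1 //.
  apply/subset_leq_card/subsetP=> y /setD1P[y_neq /imsetP[x _ def_y]].
  by apply/imsetP; exists x; rewrite // -def_y (negPf y_neq).
- move=> u v /(reach_cons e_min)[/c_reach->//|[-> /c_reach <-]].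
  by rewrite eqxx; case: ifP.
move=> u v uS vS neq_uv /(reach_cons e_min)[r_uv|[def_u /c_reach v0v]].
  by rewrite /g' (c_reach _ _ r_uv) ltn_add2r g_reach.
rewrite /g' def_u -/u0 (negPf diff) -v0v eqxx addn0 mul1n addnS ltnS.
exact: leq_trans (leq_bigmax u0) (leq_addl _ _).
Qed.

(** * Journeys along a walk *)

Fixpoint walk_arcs t x w : seq (tarc V) :=
  if w is y :: w' then (x, y, t) :: walk_arcs t.+1 y w' else [::].

Lemma size_walk_arcs t x w : size (walk_arcs t x w) = size w.
Proof. by elim: w t x => //= y w IH t x; rewrite IH. Qed.

Lemma walk_arcs_time t x w : {in walk_arcs t x w, forall e, t <= ttime e}.
Proof.
elim: w t x => //= y w IH t x e; rewrite inE => /predU1P[->//|/IH].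
exact: ltnW.
Qed.

(** A walk with two equal consecutive vertices yields a loop; this occurs when a component is a
    single feedback vertex. *)
Definition loopless E := [seq e <- E | tsrc e != tdst e].

Lemma reach_cons_arc x y t E v :
    x != y -> {in E, forall e, t < ttime e} ->
  reach E y v -> reach ((x, y, t) :: E) x v.
Proof.
move=> neq_xy late [J [JE Js uv]]; exists ((x, y, t) :: J); split.
- by move=> e; rewrite !inE => /predU1P[->|/JE->]; rewrite ?eqxx ?orbT.
- case: J JE Js uv => //= a J JE -> [def_a _]; rewrite /tstep def_a eqxx andbT.
  by apply: late; apply: JE; rewrite inE eqxx.
by split=> //; case: J uv {JE Js} => //= a J [].
Qed.

Lemma reach_walk_head t x w v :
  v \in x :: w -> reach (loopless (walk_arcs t x w)) x v.
Proof.
elim: w t x => [|y w IH] t x; rewrite in_cons => /predU1P[->|//];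
  try by exists [::].
move=> /(IH t.+1) r_yv; rewrite /loopless /= -/(loopless _).
have [def_x|neq_xy] := eqVneq x y; first by rewrite /= def_x.
apply: reach_cons_arc => // e; rewrite mem_filter => /andP[_].
exact: walk_arcs_time.
Qed.

Lemma reach_walk t x w u v :
  mem2 (x :: w) u v -> reach (loopless (walk_arcs t x w)) u v.
Proof.
elim: w t x => [|y w IH] t x; rewrite mem2_cons;
  case: eqP => [<- /(reach_walk_head t)//|_] //.
move=> /(IH t.+1 y); apply: reach_sub => e.
by rewrite !mem_filter inE => /andP[-> ->]; rewrite orbT.
Qed.

End Journeys.

(** * Feedback vertex sets, ranks and components *)

Section Feedback.
Variables (V : finType) (A : rel V).

(** Around a circuit avoiding [S], the rank would increase from a vertex to itself. *)
Lemma rank_dfvs (S : {set V}) (g : V -> nat) :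
    (forall u v, u \notin S -> v \notin S -> A u v -> g u < g v) -> dfvs A S.
Proof.
move=> g_lt c [c_neq0 /andP[c_cycle _]].
have [/hasP[x]|/hasPn cS] := boolP (has (mem S) c); first by exists x.
case: c c_neq0 c_cycle cS => // x p _ xp cS.
have tr : transitive (fun u v => g u < g v) by move=> ???; apply: ltn_trans.
suff: path (fun u v => g u < g v) x (rcons p x).
  move/(order_path_min tr)/allP/(_ x).
  by rewrite mem_rcons inE eqxx ltnn => /(_ isT).
have inP : all (fun y => y \notin S) (x :: rcons p x).
  apply/allP=> y; rewrite inE mem_rcons inE orbA orbb => yc.
  by apply: cS; rewrite inE.
by apply: sub_in_path inP xp => u v; apply: g_lt.
Qed.

(** The rank counts the vertices reachable outside [S], so here it decreases along arcs. *)
Lemma dfvs_rank (S : {set V}) : dfvs A S ->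
  exists g : V -> nat,
    forall u v, u \notin S -> v \notin S -> A u v -> g v < g u.
Proof.
move=> S_dfvs; pose B := [rel x y | [&& A x y, x \notin S & y \notin S]].
exists (fun x => #|[set y | connect B x y]|) => u v uS vS Auv.
have Buv : B u v by rewrite /= Auv uS.
apply/proper_card/properP; split.
  by apply/subsetP=> y; rewrite !inE; apply/connect_trans/connect1.
(* A path from [v] back to [u], shortened to a simple one, would close up with the arc [A u v] into
   a circuit avoiding [S]. *)
exists u; rewrite !inE ?connect0 //; apply/negP=> /connectP[p vp def_u].
case/shortenP: vp def_u => q vq q_uniq _ def_u.
have Bc : cycle B (v :: q) by rewrite /= rcons_path vq -def_u.
have [|x xc] := S_dfvs (v :: q).
  split=> //; rewrite /ucycle q_uniq andbT.
  by apply: sub_cycle Bc => ?? /and3P[].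
by apply/negP; have /and3P[] := next_cycle Bc xc.
Qed.

Lemma underlying_connect_sym : connect_sym (underlying A).
Proof. by apply: sym_connect_sym => x y; rewrite /underlying orbC. Qed.

Lemma root_arc u v : A u v -> root (underlying A) u = root (underlying A) v.
Proof.
move=> Auv; apply/eqP; rewrite (root_connect underlying_connect_sym).
by apply: connect1; rewrite /underlying Auv.
Qed.

Lemma card_labels_num_cc (c : V -> V) :
  (forall u v, A u v -> c u = c v) -> #|c @: V| <= num_cc A.
Proof.
move=> c_arc; have c_con u v : connect (underlying A) u v -> c u = c v.
  case/connectP=> p up ->; elim: p u up => //= w p IH u /andP[uw /IH <-].
  by case/orP: uw => /c_arc.
rewrite /num_cc /n_comp_mem.
apply: leq_trans (leq_imset_card c _).
apply/subset_leq_card/subsetP=> y /imsetP[x _ ->].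
apply/imsetP; exists (root (underlying A) x); last exact/c_con/connect_root.
by rewrite !inE andbT roots_root //; apply: underlying_connect_sym.
Qed.

Lemma dfvs_of_journeys (G : temporal_digraph V) :
    irreflexive A -> (forall u v, A u v -> has_journey G u v) ->
  exists2 S : {set V}, dfvs A S & #|V| + #|S| <= #|` tarcs G |%fset + num_cc A.
Proof.
move=> A_irr GA; pose E := sort (fun e e' => ttime e <= ttime e') (tarcs G).
have E_sorted : sorted (fun e e' => ttime e <= ttime e') E.
  by apply: sort_sorted => e e'; apply: leq_total.
have GE : tarcs G =i E by move=> e; rewrite mem_sort.
have [S [g [c [le_size c_reach g_reach]]]] := feedback_labelling E_sorted.
have reachA u v : A u v -> reach E u v by move/GA/(has_journeyE _ _ GE).
exists S.
  apply: (rank_dfvs (g := g)) => u v uS vS Auv; apply: g_reach => //.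
    (* Trivial journeys do not increase the rank; irreflexivity rules them out. *)
    by apply: contraTneq Auv => ->; rewrite A_irr.
  exact: reachA.
rewrite addnC; apply: leq_trans le_size _; rewrite size_sort leq_add2l.
by apply: card_labels_num_cc => u v /reachA/c_reach.
Qed.

Lemma component_walk (S : {set V}) (r : V) :
    dfvs A S -> r \in roots (underlying A) ->
  exists E : seq (tarc V),
  [/\ (size E).+1 <= \sum_(x | root (underlying A) x == r) (1 + (x \in S)),
      all (fun e => (tsrc e != tdst e) && (0 < ttime e)) E
    & forall u v, root (underlying A) u = r -> A u v -> reach E u v].
Proof.
move=> /dfvs_rank[g g_lt] r_root.
pose C := [pred x | root (underlying A) x == r].
pose s := enum [predI C & S].
pose leg x y := g y <= g x.
(* As [g] decreases along arcs, sorting by decreasing [g] puts tails before heads. *)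
pose m := sort leg (enum [predD C & S]).
have mem_s x : (x \in s) = (x \in C) && (x \in S) by rewrite mem_enum.
have mem_m x : (x \in m) = (x \notin S) && (x \in C) by rewrite mem_sort mem_enum.
have size_w : size (s ++ m ++ s) = \sum_(x | C x) (1 + (x \in S)).
  rewrite !size_cat size_sort -!cardE addnA cardID big_split /= sum1_card.
  congr (_ + _); rewrite -sum1_card big_mkcondr /=.
  by apply: eq_bigr => x _; case: (x \in S).
have walk u v : u \in C -> A u v -> mem2 (s ++ m ++ s) u v.
  move=> uC Auv; have vC : v \in C by rewrite inE -(root_arc Auv).
  (* A tail in [S] is taken in the first copy of [s], a head in [S] in the last; only arcs outside
     [S] need the order of [m]. *)
  have [uS|uS] := boolP (u \in S); have [vS|vS] := boolP (v \in S);
    rewrite !mem2_cat !mem_cat !mem_s !mem_m uC vC ?uS ?vS ?(negPf uS) ?(negPf vS)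
            ?orbT //=.
  suff -> : mem2 m u v by rewrite !orbT.
  apply: (@sorted_mem2 _ leg); rewrite ?mem_m ?uS ?vS //.
  - by move=> x; apply: leqnn.
  - by move=> x y z; rewrite /leg => xy yz; apply: leq_trans yz xy.
  - by apply: sort_sorted => x y; apply: leq_total.
  by rewrite /leg -ltnNge g_lt.
(* The walk is nonempty, so it has one step fewer than it has vertices. *)
have rC : r \in s ++ m ++ s.
  rewrite !mem_cat mem_s mem_m !inE.
  by have -> := eqP r_root; rewrite eqxx; case: (r \in S).
case: (s ++ m ++ s) size_w walk rC => // x w size_w walk _.
exists (loopless (walk_arcs 1 x w)); split.
- by rewrite -size_w ltnS size_filter -[X in _ <= X](size_walk_arcs 1 x) count_size.
- by apply/allP=> e; rewrite mem_filter => /andP[-> /walk_arcs_time].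
by move=> u v /eqP uC /(walk u v uC); apply: reach_walk.
Qed.

(** The walks of all components share the times from 1 on, which is harmless since a union of arc
    sets keeps all journeys. The step saved in each component accounts for [num_cc A]. *)
Lemma journeys_of_dfvs (S : {set V}) : dfvs A S ->
  exists2 G : temporal_digraph V,
    #|` tarcs G |%fset + num_cc A <= #|V| + #|S| &
    forall u v, A u v -> has_journey G u v.
Proof.
move=> S_dfvs; set e := underlying A.
have walk r : exists E : seq (tarc V), r \in roots e ->
    [/\ (size E).+1 <= \sum_(x | root e x == r) (1 + (x \in S)),
        all (fun a => (tsrc a != tdst a) && (0 < ttime a)) E
      & forall u v, root e u = r -> A u v -> reach E u v].
  have [r_root|r_nroot] := boolP (r \in roots e); last by exists [::].
  by have [E] := component_walk S_dfvs r_root; exists E.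
have [F F_walk] := fin_all_exists walk.
pose E := flatten [seq F r | r <- enum (roots e)].
have E_arcs a : a \in E -> (tsrc a != tdst a) && (0 < ttime a).
  case/flatten_mapP=> r; rewrite mem_enum => /F_walk[_ /allP Fr _]; exact: Fr.
have [D [mem_D size_D]] : exists D : {fset tarc V}%fset, D =i E /\ #|` D|%fset <= size E.
  exists (seq_fset tt E); split; first exact: seq_fsetE.
  by rewrite size_seq_fset size_undup.
have G_loopless u v t : (u, v, t) \in D -> u != v.
  by rewrite mem_D => /E_arcs/andP[].
have G_time u v t : (u, v, t) \in D -> 0 < t.
  by rewrite mem_D => /E_arcs/andP[].
have root_e x : root e x \in roots e.
  exact: (roots_root underlying_connect_sym).
exists (TemporalDigraph G_loopless G_time) => /= [|u v Auv].
  have -> : #|V| + #|S| = \sum_x (1 + (x \in S)).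
    by rewrite big_split /= sum1_card -big_mkcond /= sum1_card.
  rewrite (partition_big (root e) (mem (roots e))) //=.
  apply: leq_trans (leq_add size_D (leqnn _)) _.
  rewrite size_flatten /shape -map_comp sumnE big_map big_enum /=.
  have -> : num_cc A = \sum_(r in roots e) 1.
    by rewrite sum1_card; apply: eq_card => r; rewrite !inE andbT.
  rewrite -big_split /=; apply: leq_sum => r /F_walk[+ _ _].
  by rewrite addn1.
apply/(@has_journeyE _ (TemporalDigraph G_loopless G_time) E) => //.
have [_ _ /(_ u v erefl Auv)] := F_walk _ (root_e u).
apply: reach_sub => a aF; apply/flatten_mapP; exists (root e u) => //.
by rewrite mem_enum.
Qed.

End Feedback.

Theorem theorem3p5 (V : finType) (A : rel V) (A_loopless : irreflexive A)
    (f : nat) (f_min : min_dfvs_size A f) (k : nat) :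
  (exists2 G : temporal_digraph V,
      #|` tarcs G |%fset <= k &
      forall u v : V, A u v -> has_journey G u v)
  <-> k >= #|V| + f - num_cc A.
Proof.
case: f_min => -[S0 S0_dfvs S0_card] f_le; split=> [[G Gk GA]|le_k].
  have [S /f_le le_f le_S] := dfvs_of_journeys A_loopless GA.
  rewrite leq_subLR; apply: leq_trans (leq_add (leqnn _) Gk).
  by rewrite [_ + #|`_|%fset]addnC; apply: leq_trans le_S; rewrite leq_add2l.
have [G G_size GA] := journeys_of_dfvs S0_dfvs; exists G => //.
apply: leq_trans le_k; rewrite -S0_card.
(* The subtraction is not truncated: [G_size] bounds [num_cc A]. *)
by rewrite -(leq_add2r (num_cc A)) subnK // (leq_trans (leq_addl _ _) G_size).
Qed.
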